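(* Let $V_A$ and $V_B$ be disjoint finite nonempty sets, let $G_K$ be the complete bipartite graph with bipartition $(V_A,V_B)$, let $G_A=(V_A,E_A)$ and $G_B=(V_B,E_B)$ be simple unweighted graphs, and let $G' = G_K\cup G_A\cup G_B$ (the graph on $V_A\cup V_B$ whose edges are those of $G_A$, those of $G_B$, and all pairs $uv$ with $u\in V_A$, $v\in V_B$). Suppose $|V_A|<|V_B|$ and that $\deg_{G_B}(v)\le \tfrac12|V_A|$ for every $v\in V_B$, where $\deg_{G_B}(v)$ is the degree of $v$ in $G_B$ (equivalently, in the subgraph of $G'$ induced by $V_B$). Then $G'$ is exact and the optimal MAXCUT SDP solution of $G'$ is unique.
   Context: All graphs are finite, simple and unweighted (every edge has weight $1$). The Laplacian $\mathcal{L}_G$ of a graph $G=(V,E)$ with edge weights $w_{ij}$ ($w_{ij}=0$ for non-edges) is the $V\times V$ matrix with off-diagonal entries $-w_{ij}$ and diagonal entries $\sum_{j\ne i}w_{ij}$. The MAXCUT SDP of $G$ is: maximize $\frac14\langle \mathcal{L}_G,\mathbf{X}\rangle$ over symmetric matrices $\mathbf{X}\in\mathbb{R}^{V\times V}$ with $X_{ii}=1$ for all $i\in V$ and $\mathbf{X}\succeq \mathbf{0}$, where $\langle \mathbf{A},\mathbf{B}\rangle=\operatorname{tr}(\mathbf{A}\mathbf{B})$. $\mathrm{MAXCUT}(G)$ is the maximum, over partitions $(S,V\setminus S)$ of $V$, of the total weight of edges with exactly one endpoint in $S$. $G$ is called exact if the optimal value of the MAXCUT SDP of $G$ equals $\mathrm{MAXCUT}(G)$;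 equivalently, if the MAXCUT SDP has an optimal solution of rank $1$. *)

(* Defs.v *)
From mathcomp Require Import all_boot all_order all_algebra.
From mathcomp Require Import reals.

Set Implicit Arguments.
Unset Strict Implicit.
Unset Printing Implicit Defensive.

Import Order.TTheory GRing.Theory Num.Theory.
Local Open Scope ring_scope.

Record sgraph (V : finType) := SGraph {
  adj :> rel V;
  adj_sym : symmetric adj;
  adj_irr : irreflexive adj
}.

Definition degree (V : finType) (G : sgraph V) (v : V) : nat :=
  #|[set u | G v u]|.

(* The disjoint union of the vertex sets is the sum type VA + VB. *)
Definition join_rel (VA VB : finType) (GA : sgraph VA) (GB : sgraph VB) :
    rel (VA + VB)%type :=
  fun x y => match x, y with
  | inl a, inl a' => GA a a'
  | inr b, inr b' => GB b b'
  | _, _ => true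
  end.

Lemma join_sym (VA VB : finType) (GA : sgraph VA) (GB : sgraph VB) :
  symmetric (join_rel GA GB).
Proof. by move=> [a|b] [a'|b'] //=; apply: adj_sym. Qed.

Lemma join_irr (VA VB : finType) (GA : sgraph VA) (GB : sgraph VB) :
  irreflexive (join_rel GA GB).
Proof. by move=> [a|b] /=; apply: adj_irr. Qed.

Definition join (VA VB : finType) (GA : sgraph VA) (GB : sgraph VB) :
    sgraph (VA + VB)%type :=
  SGraph (join_sym GA GB) (join_irr GA GB).

Section MaxCut.
Variables (R : realType) (V : finType) (G : sgraph V).

Definition weight (u v : V) : R := (G u v)%:R.

(* V x V matrices have type 'M[R]_#|V|: the index i stands for the vertex
   enum_val i. *)
Definition laplacian : 'M[R]_#|V| :=
  \matrix_(i, j)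
    if i == j then \sum_(v | v != enum_val i) weight (enum_val i) v
    else - weight (enum_val i) (enum_val j).

Definition psd (n : nat) (X : 'M[R]_n) : Prop :=
  forall x : 'cV[R]_n, 0 <= (x^T *m X *m x) 0 0.

Definition sdp_feasible (X : 'M[R]_#|V|) : Prop :=
  [/\ X^T = X, forall i, X i i = 1 & psd X].

Definition sdp_objective (X : 'M[R]_#|V|) : R :=
  4^-1 * \tr (laplacian *m X).

Definition sdp_optimal (X : 'M[R]_#|V|) : Prop :=
  sdp_feasible X /\
  forall Y, sdp_feasible Y -> sdp_objective Y <= sdp_objective X.

Definition sdp_value (c : R) : Prop :=
  exists2 X, sdp_optimal X & sdp_objective X = c.

(* Every cut edge is counted once, oriented from S to its complement. *)
Definition cut_weight (S : {set V}) : nat :=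
  #|[set p : V * V | [&& G p.1 p.2, p.1 \in S & p.2 \notin S]]|.

Definition maxcut : nat := \max_(S : {set V}) cut_weight S.

Definition exact : Prop := sdp_value maxcut%:R.

End MaxCut.
Arguments exact R {V} G.

(* Main.v *)
Require Import Defs.
From mathcomp Require Import all_boot all_order all_algebra.
From mathcomp Require Import reals ring lra.
Import Order.TTheory GRing.Theory Num.Theory.
Local Open Scope ring_scope.

(** A feasible matrix [X] is a Gram matrix of unit vectors: its vertex vectors
    are the coordinate vectors, measured in the seminorm [x -> sqrt (x^T X x)].
    Reflect the vectors of [VB] through the origin and call [a_i], [b_j] the
    resulting vectors of [VA] and [VB]. With [m = #|VA|] and [n = #|VB|], the
    objective becomes
      [m n - 1/4 (sum_ij |a_i - b_j|^2 - sum_GA |a_i - a_i'|^2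
                                       - sum_GB |b_j - b_j'|^2)],
    where the last two sums are over edges counted once
    ([sdp_objective_join]). The cut [VA | VB] makes all these vectors coincide
    and has value [m n], so it is optimal as soon as the cross distances
    dominate the inner ones.

    That comparison is made through the scatters [SA] and [SB] (sums of squared
    distances to the centroid). The parallel axis identity gives
      [sum_ij |a_i - b_j|^2 = n SA + m SB + m n |centroid a - centroid b|^2]
    ([cross_sumE]). The edges of [GA] cost at most as much as those of the
    complete graph, which is [m SA] ([edge_sum_le_complete]); the edges of [GB]
    cost at most twice the maximal degree times [SB], hence at most [m SB]
    ([edge_sum_le_degree]). Since [m < n], the difference is nonnegative.

    For uniqueness, an optimal [X] has [SA = 0] and equal centroids. The
    centroid of the unit vectors [b_j] is then a unit vector, which forces
    [SB = 0] ([inner_edges_eq]). All the reflected vectors are at distance zero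
    from one another, and this determines the entries of [X] ([eq_cut_mx]). *)

(** * Squared distances in the seminorm of a positive semidefinite matrix *)

Section Seminorm.
Context {R : realType} {N : nat} (X : 'M[R]_N).
Hypotheses (X_sym : X^T = X) (X_psd : psd X).
Implicit Types x y z : 'cV[R]_N.

Definition dot x y : R := (x^T *m X *m y) 0 0.
Definition sqnorm x : R := dot x x.

Lemma dotC x y : dot x y = dot y x.
Proof.
rewrite /dot; have <- : (y^T *m X *m x)^T = x^T *m X *m y.
  by rewrite !trmx_mul trmxK X_sym mulmxA.
by rewrite mxE.
Qed.

Lemma dotDl x y z : dot (x + y) z = dot x z + dot y z.
Proof. by rewrite /dot linearD /= !mulmxDl mxE. Qed.

Lemma dotZl (c : R) x y : dot (c *: x) y = c * dot x y.
Proof. by rewrite /dot linearZ /= -!scalemxAl mxE. Qed.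

Lemma dotDr x y z : dot x (y + z) = dot x y + dot x z.
Proof. by rewrite dotC dotDl !(dotC x). Qed.

Lemma dotZr (c : R) x y : dot x (c *: y) = c * dot x y.
Proof. by rewrite dotC dotZl dotC. Qed.

Lemma dot_suml (I : finType) (a : I -> 'cV[R]_N) y :
  dot (\sum_i a i) y = \sum_i dot (a i) y.
Proof. by rewrite /dot linear_sum /= !mulmx_suml summxE. Qed.

Lemma sqnorm_ge0 x : 0 <= sqnorm x.
Proof. exact: X_psd. Qed.

Lemma sqnormD x y : sqnorm (x + y) = sqnorm x + 2 * dot x y + sqnorm y.
Proof. by rewrite /sqnorm dotDl !dotDr (dotC y x); ring. Qed.

Lemma sqnormZ (c : R) x : sqnorm (c *: x) = c ^+ 2 * sqnorm x.
Proof. by rewrite /sqnorm dotZl dotZr; ring. Qed.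

Lemma sqnormN x : sqnorm (- x) = sqnorm x.
Proof. by rewrite -scaleN1r sqnormZ; ring. Qed.

Lemma sqnormBC x y : sqnorm (x - y) = sqnorm (y - x).
Proof. by rewrite -sqnormN opprB. Qed.

Lemma sqnormB x y : sqnorm (x - y) = sqnorm x - 2 * dot x y + sqnorm y.
Proof. by rewrite sqnormD sqnormN -scaleN1r dotZr; ring. Qed.

(** The parallelogram law, of which the second square is dropped. *)
Lemma sqnormB_le x y z :
  sqnorm (x - y) <= 2 * (sqnorm (x - z) + sqnorm (y - z)).
Proof.
have -> : x - y = (x - z) - (y - z) by rewrite opprB addrA subrK.
move: (x - z) (y - z) => u v; have := sqnorm_ge0 (u + v).
by rewrite sqnormD sqnormB; lra.
Qed.

Lemma sqnormB_eq0_trans x y z :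
  sqnorm (x - z) = 0 -> sqnorm (y - z) = 0 -> sqnorm (x - y) = 0.
Proof.
move=> xz yz; have := sqnormB_le x y z; have := sqnorm_ge0 (x - y).
by rewrite xz yz; lra.
Qed.

(** A null vector is orthogonal to everything: otherwise some multiple of it,
    added to [x], would make the square of the seminorm negative. *)
Lemma dot_null x y : sqnorm y = 0 -> dot x y = 0.
Proof.
move=> y0; apply/eqP/negP => /negP nz.
have := sqnorm_ge0 (x - ((sqnorm x + 1) / (2 * dot x y)) *: y).
rewrite sqnormB sqnormZ y0 dotZr.
have -> : 2 * ((sqnorm x + 1) / (2 * dot x y) * dot x y) = sqnorm x + 1.
  by field.
by lra.
Qed.

Lemma sqnorm_eq_of_null x y : sqnorm (x - y) = 0 -> sqnorm x = sqnorm y.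
Proof.
move=> xy0; have xE : x = y + (x - y) by rewrite addrC subrK.
by rewrite [in LHS]xE sqnormD dot_null // xy0; ring.
Qed.

Section Points.
Context {I : finType} (a : I -> 'cV[R]_N).

Definition centroid : 'cV[R]_N := #|I|%:R^-1 *: \sum_i a i.
Definition scatter : R := \sum_i sqnorm (a i - centroid).

Lemma scatter_ge0 : 0 <= scatter.
Proof. by apply: sumr_ge0 => i _; apply: sqnorm_ge0. Qed.

Lemma scatter_eq0 i : scatter = 0 -> sqnorm (a i - centroid) = 0.
Proof.
move/eqP; rewrite psumr_eq0 => [/allP/(_ i)|j _]; last exact: sqnorm_ge0.
by rewrite mem_index_enum => /(_ isT)/eqP.
Qed.

(** Huygens' parallel axis identity: the deviations from the centroid sum to
    zero, so that the cross terms cancel. *)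
Lemma sum_sqnorm_centroid x : (0 < #|I|)%N ->
  \sum_i sqnorm (a i - x) = scatter + #|I|%:R * sqnorm (centroid - x).
Proof.
move=> I_gt0; set c := centroid.
have dev0 : \sum_i (a i - c) = 0.
  rewrite sumrB sumr_const -scaler_nat /c /centroid scalerA divff ?scale1r ?subrr //.
  by rewrite pnatr_eq0 -lt0n.
have split_dev i : sqnorm (a i - x) =
    sqnorm (a i - c) + 2 * dot (a i - c) (c - x) + sqnorm (c - x).
  by rewrite -sqnormD addrA subrK.
rewrite (eq_bigr _ (fun i _ => split_dev i)) !big_split /= -mulr_sumr -dot_suml.
rewrite dev0 sumr_const -mulr_natl.
have -> : dot 0 (c - x) = 0 by rewrite -(scale0r 0) dotZl mul0r.
by rewrite /scatter -/c; ring.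
Qed.

(** The parallel axis identity at the origin. *)
Lemma scatter_unit : (0 < #|I|)%N -> (forall i, sqnorm (a i) = 1) ->
  scatter = #|I|%:R * (1 - sqnorm centroid).
Proof.
move=> I_gt0 unit_a; have := sum_sqnorm_centroid 0 I_gt0.
rewrite subr0 (eq_bigr (fun=> 1)) => [|i _]; last by rewrite subr0.
by rewrite sumr_const mulrBr mulr1; lra.
Qed.

(** Every edge is counted twice, once in each direction. *)
Definition edge_sum (G : sgraph I) : R :=
  \sum_i \sum_j (G i j)%:R * sqnorm (a i - a j).

(** The complete graph attains equality: summing the parallel axis identity
    over the points themselves yields the scatter twice. *)
Lemma edge_sum_le_complete (G : sgraph I) : (0 < #|I|)%N ->
  edge_sum G <= 2 * (#|I|%:R * scatter).
Proof.
move=> I_gt0.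
apply: (@le_trans _ _ (\sum_i \sum_j sqnorm (a j - a i))).
  apply: ler_sum => i _; apply: ler_sum => j _; rewrite (sqnormBC (a j)).
  by case: (G i j); rewrite ?mul1r ?mul0r ?sqnorm_ge0.
under eq_bigr => i _ do rewrite sum_sqnorm_centroid // sqnormBC.
rewrite big_split /= sumr_const -mulr_sumr -/scatter -mulr_natl.
by rewrite le_eqVlt; apply/orP; left; apply/eqP; ring.
Qed.

(** Each edge is split at the centroid, at the price of a factor 2; a point
    is then charged once for every edge through it, so at most [d] times in
    each of the two directions. *)
Lemma edge_sum_le_degree (G : sgraph I) (d : R) :
  (forall i, (degree G i)%:R <= d) -> edge_sum G <= 4 * (d * scatter).
Proof.
move=> deg_le; pose c := centroid.
have degE i : \sum_j (G i j)%:R = (degree G i)%:R :> R.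
  rewrite /degree -sum1_card natr_sum [RHS]big_mkcond /=.
  by apply: eq_bigr => j _; rewrite inE; case: (G i j).
pose T := \sum_i (degree G i)%:R * sqnorm (a i - c).
have T_le : T <= d * scatter.
  rewrite /scatter mulr_sumr; apply: ler_sum => i _.
  by rewrite ler_wpM2r ?sqnorm_ge0.
have outE : \sum_i \sum_j (G i j)%:R * sqnorm (a i - c) = T.
  by apply: eq_bigr => i _; rewrite -mulr_suml degE.
have inE' : \sum_i \sum_j (G i j)%:R * sqnorm (a j - c) = T.
  rewrite exchange_big /=; apply: eq_bigr => j _; rewrite -mulr_suml.
  by rewrite -degE; congr (_ * _); apply: eq_bigr => i _; rewrite adj_sym.
have: edge_sum G <= 2 * (T + T).
  rewrite -{1}outE -inE' -big_split mulr_sumr; apply: ler_sum => i _ /=.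
  rewrite -big_split mulr_sumr; apply: ler_sum => j _ /=.
  case: (G i j); rewrite ?mul1r ?mul0r; last by rewrite addr0 mulr0.
  exact: sqnormB_le.
by lra.
Qed.

End Points.

(** Both families contribute their scatter with the size of the other family
    as a factor, which is what lets a larger side absorb all the edges inside
    the smaller one. *)
Lemma cross_sumE (I J : finType) (a : I -> 'cV[R]_N) (b : J -> 'cV[R]_N) :
  (0 < #|I|)%N -> (0 < #|J|)%N ->
  \sum_i \sum_j sqnorm (a i - b j) =
    #|J|%:R * scatter a + #|I|%:R * scatter b
    + #|I|%:R * #|J|%:R * sqnorm (centroid a - centroid b).
Proof.
move=> I_gt0 J_gt0; rewrite exchange_big /=.
under eq_bigr => j _ do rewrite sum_sqnorm_centroid // sqnormBC.
rewrite big_split /= sumr_const -mulr_sumr sum_sqnorm_centroid // -mulr_natl.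
by rewrite (sqnormBC (centroid b)); ring.
Qed.

Section TwoFamilies.
Context {I J : finType} (a : I -> 'cV[R]_N) (b : J -> 'cV[R]_N).
Context (GI : sgraph I) (GJ : sgraph J).
Hypotheses (I_gt0 : (0 < #|I|)%N) (lt_IJ : (#|I| < #|J|)%N).
Hypothesis deg_GJ : forall j, (degree GJ j)%:R <= 2^-1 * #|I|%:R :> R.

Let J_gt0 : (0 < #|J|)%N := leq_ltn_trans (leq0n _) lt_IJ.

(** The degree bound [#|I| / 2] is what makes the scatter of [b] cancel: the
    edges of [GJ] use up all of its coefficient [#|I|] in the cross sum. *)
Lemma inner_edge_gap :
  (#|J|%:R - #|I|%:R) * scatter a
    + #|I|%:R * #|J|%:R * sqnorm (centroid a - centroid b)
  <= \sum_i \sum_j sqnorm (a i - b j) - (edge_sum a GI + edge_sum b GJ) / 2.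
Proof.
rewrite cross_sumE //.
have := edge_sum_le_complete a GI I_gt0.
have := edge_sum_le_degree b GJ _ deg_GJ.
by rewrite mulrDl mulrBl; lra.
Qed.

Let coeffs_gt0 : (0 < #|J|%:R - #|I|%:R :> R) * (0 < #|I|%:R * #|J|%:R :> R).
Proof. by rewrite subr_gt0 ltr_nat lt_IJ mulr_gt0 ?ltr0n. Qed.

Lemma inner_edges_le :
  (edge_sum a GI + edge_sum b GJ) / 2 <= \sum_i \sum_j sqnorm (a i - b j).
Proof.
have [nm_gt0 mn_gt0] := coeffs_gt0.
have := mulr_ge0 (ltW nm_gt0) (scatter_ge0 a).
have := mulr_ge0 (ltW mn_gt0) (sqnorm_ge0 (centroid a - centroid b)).
by have := inner_edge_gap; lra.
Qed.

(** Equality forces the first family and the centroid of the second onto one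
    point. The second family may still be spread out as far as the edge
    inequality is concerned; but its centroid is then a unit vector, and an
    average of unit vectors has norm 1 only if they all coincide. *)
Lemma inner_edges_eq :
  (forall i, sqnorm (a i) = 1) -> (forall j, sqnorm (b j) = 1) ->
  (edge_sum a GI + edge_sum b GJ) / 2 = \sum_i \sum_j sqnorm (a i - b j) ->
  exists c, (forall i, sqnorm (a i - c) = 0) /\ (forall j, sqnorm (b j - c) = 0).
Proof.
move=> unit_a unit_b eq_sums; have := inner_edge_gap; rewrite eq_sums subrr.
have [nm_gt0 mn_gt0] := coeffs_gt0.
have ge0_1 := mulr_ge0 (ltW nm_gt0) (scatter_ge0 a).
have ge0_2 := mulr_ge0 (ltW mn_gt0) (sqnorm_ge0 (centroid a - centroid b)).
move=> gap_le0.
have scatter_a0 : scatter a = 0.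
  have /eqP : (#|J|%:R - #|I|%:R) * scatter a = 0 by lra.
  by rewrite mulf_eq0 (gt_eqF nm_gt0) => /eqP.
have ab0 : sqnorm (centroid a - centroid b) = 0.
  have /eqP : #|I|%:R * #|J|%:R * sqnorm (centroid a - centroid b) = 0 by lra.
  by rewrite mulf_eq0 (gt_eqF mn_gt0) => /eqP.
have scatter_b0 : scatter b = 0.
  rewrite scatter_unit // -(sqnorm_eq_of_null _ _ ab0).
  have /eqP := scatter_unit a I_gt0 unit_a.
  rewrite scatter_a0 eq_sym mulf_eq0 pnatr_eq0 gtn_eqF //= => /eqP ->.
  by rewrite mulr0.
exists (centroid b); split => [i|j]; last exact: scatter_eq0.
apply: (sqnormB_eq0_trans _ _ (centroid a)); first exact: scatter_eq0.
by rewrite sqnormBC.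
Qed.

End TwoFamilies.
End Seminorm.

(** * Cuts as feasible points of the semidefinite program *)

Section Cuts.
Context {R : realType} {V : finType} (G : sgraph V).
Implicit Types (X : 'M[R]_#|V|) (S : {set V}) (u v : V).

Definition entry X u v : R := X (enum_rank u) (enum_rank v).

Definition side S u : R := if u \in S then 1 else -1.

Definition cut_mx S : 'M[R]_#|V| :=
  \matrix_(i, j) (side S (enum_val i) * side S (enum_val j)).

Lemma side2 S u : side S u * side S u = 1.
Proof. by rewrite /side; case: ifP => _; ring. Qed.

Lemma entry_cut_mx S u v : entry (cut_mx S) u v = side S u * side S v.
Proof. by rewrite /entry mxE !enum_rankK. Qed.

Lemma eq_entry X Y : entry X =2 entry Y -> X = Y.
Proof.
move=> eqXY; apply/matrixP => i j.
by have := eqXY (enum_val i) (enum_val j); rewrite /entry !enum_valK.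
Qed.

Lemma cut_mx_feasible S : sdp_feasible (cut_mx S).
Proof.
split.
- by apply/matrixP => i j; rewrite !mxE mulrC.
- by move=> i; rewrite mxE side2.
- pose s : 'cV[R]_#|V| := \col_i side S (enum_val i).
  (* The quadratic form of a rank 1 matrix [s s^T] is the square [(s^T x)^2]. *)
  have -> : cut_mx S = s *m s^T.
    by apply/matrixP => i j; rewrite !mxE big_ord1 !mxE.
  move=> x; rewrite mulmxA -mulmxA mxE big_ord1.
  have -> : s^T *m x = (x^T *m s)^T by rewrite trmx_mul trmxK.
  by rewrite [X in _ * X]mxE -expr2 sqr_ge0.
Qed.

Lemma sdp_objectiveE X : sdp_feasible X ->
  sdp_objective G X = 4^-1 * \sum_u \sum_v (G u v)%:R * (1 - entry X u v).
Proof.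
move=> [X_sym X_diag _]; rewrite /sdp_objective; congr (_ * _).
rewrite /mxtrace (reindex (@enum_rank V)) /=; last first.
  by apply: onW_bij; apply: enum_rank_bij.
apply: eq_bigr => u _; rewrite mxE (reindex (@enum_rank V)) /=; last first.
  by apply: onW_bij; apply: enum_rank_bij.
rewrite (bigD1 u) //= [RHS](bigD1 u) //= adj_irr mul0r add0r.
rewrite mxE eqxx X_diag mulr1 enum_rankK -big_split /=.
apply: eq_bigr => v vu; rewrite mxE (inj_eq enum_rank_inj) eq_sym (negbTE vu).
by rewrite !enum_rankK /weight /entry -{1}X_sym mxE; ring.
Qed.

Lemma sdp_objective_cut_mx S : sdp_objective G (cut_mx S) = (cut_weight G S)%:R.
Proof.
rewrite sdp_objectiveE; last exact: cut_mx_feasible.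
(* The objective sees each cut edge in both orientations. *)
pose out u v : R := ([&& G u v, u \in S & v \notin S])%:R.
have cutE : (cut_weight G S)%:R = \sum_u \sum_v out u v.
  rewrite pair_big /= /cut_weight -sum1_card natr_sum [LHS]big_mkcond /=.
  by apply: eq_bigr => -[u v] _; rewrite inE /out /=; case: (andb _ _).
have -> : \sum_u \sum_v (G u v)%:R * (1 - entry (cut_mx S) u v)
    = 2 * (\sum_u \sum_v out u v + \sum_u \sum_v out v u).
  rewrite -big_split mulr_sumr; apply: eq_bigr => u _ /=.
  rewrite -big_split mulr_sumr; apply: eq_bigr => v _ /=.
  rewrite entry_cut_mx /side /out (adj_sym G v u).
  by case: (G u v); case: (u \in S); case: (v \in S) => /=; ring.
by rewrite [X in _ + X]exchange_big -cutE /=; field.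
Qed.

(** All cuts are feasible, so a cut that is optimal among feasible matrices is
    in particular a maximum cut. *)
Lemma exact_of_optimal_cut S : sdp_optimal G (cut_mx S) -> exact R G.
Proof.
move=> opt; exists (cut_mx S) => //; rewrite sdp_objective_cut_mx.
congr (_%:R); apply/eqP; rewrite eqn_leq leq_bigmax_cond //=.
apply/bigmax_leqP => T _; rewrite -(ler_nat R) -!sdp_objective_cut_mx.
by apply: opt.2; apply: cut_mx_feasible.
Qed.

(** The reflection makes the vectors of a cut coincide: in the seminorm of
    [cut_mx S] they are all at distance zero from one another. *)
Definition flipped S u : 'cV[R]_#|V| := side S u *: delta_mx (enum_rank u) 0.

Lemma dot_flipped X S u v :
  dot X (flipped S u) (flipped S v) = side S u * side S v * entry X u v.
Proof.
rewrite /flipped dotZl /dot -scalemxAr trmx_delta -rowE -colE !mxE.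
by rewrite mulrA.
Qed.

Section Feasible.
Context (X : 'M[R]_#|V|) (S : {set V}).
Hypothesis X_feas : sdp_feasible X.

Lemma sqnorm_flipped u : sqnorm X (flipped S u) = 1.
Proof.
by case: X_feas => _ diag _; rewrite /sqnorm dot_flipped side2 /entry diag mulr1.
Qed.

Lemma sqnorm_flippedB u v :
  sqnorm X (flipped S u - flipped S v) = 2 - 2 * (side S u * side S v * entry X u v).
Proof.
case: X_feas => X_sym _ _.
by rewrite sqnormB // !sqnorm_flipped dot_flipped; ring.
Qed.

(** Unit vectors at distance zero have inner product 1, and reflecting back
    gives the entry [side S u * side S v]. *)
Lemma eq_cut_mx :
  (forall u v, sqnorm X (flipped S u - flipped S v) = 0) -> X = cut_mx S.
Proof.
move=> null; apply: eq_entry => u v; have := null u v.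
rewrite sqnorm_flippedB entry_cut_mx /side.
by do 2![case: ifP => _]; lra.
Qed.

End Feasible.
End Cuts.

(** * The join of two graphs *)

Section Join.
Context {R : realType} {VA VB : finType} (GA : sgraph VA) (GB : sgraph VB).
Hypotheses (VA_gt0 : (0 < #|VA|)%N) (lt_VA_VB : (#|VA| < #|VB|)%N).
Hypothesis deg_GB : forall v, (degree GB v)%:R <= 2^-1 * #|VA|%:R :> R.

Definition left_side : {set VA + VB} := [set x | if x is inl _ then true else false].

Local Notation G := (join GA GB).
Local Notation S := left_side.

Section Feasible.
Context (X : 'M[R]_#|{: VA + VB}|).
Hypothesis X_feas : sdp_feasible X.

Let a (i : VA) := flipped (R := R) S (inl i).
Let b (j : VB) := flipped (R := R) S (inr j).

Let cross : R := \sum_i \sum_j sqnorm X (a i - b j).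
Let inner : R := edge_sum X a GA + edge_sum X b GB.

(** The reflection turns each crossing edge from a gain of [|x_i - x_j|^2] into
    a constant minus such a term, so that crossing and inner edges compete. *)
Lemma sdp_objective_join :
  sdp_objective G X = #|VA|%:R * #|VB|%:R - 4^-1 * (cross - inner / 2).
Proof.
rewrite sdp_objectiveE // big_sumType /=.
under eq_bigr => i _ do rewrite big_sumType /=.
under [X in _ + X]eq_bigr => j _ do rewrite big_sumType /=.
rewrite !big_split /= [X in _ + (X + _)]exchange_big /=.
have AA : \sum_i \sum_i' (GA i i')%:R * (1 - entry X (inl i) (inl i'))
    = edge_sum X a GA / 2.
  rewrite /edge_sum mulr_suml; apply: eq_bigr => i _; rewrite mulr_suml.
  apply: eq_bigr => i' _; rewrite /a sqnorm_flippedB // /side !inE.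
  by field.
have BB : \sum_j \sum_j' (GB j j')%:R * (1 - entry X (inr j) (inr j'))
    = edge_sum X b GB / 2.
  rewrite /edge_sum mulr_suml; apply: eq_bigr => i _; rewrite mulr_suml.
  apply: eq_bigr => i' _; rewrite /b sqnorm_flippedB // /side !inE.
  by field.
have twice : \sum_(i : VA) \sum_(j : VB) (2 : R) = 2 * (#|VA|%:R * #|VB|%:R).
  by rewrite !sumr_const -mulrnA -[LHS]mulr_natr natrM; ring.
have AB : \sum_i \sum_j 1%:R * (1 - entry X (inl i) (inr j))
    = 2 * (#|VA|%:R * #|VB|%:R) - cross / 2.
  rewrite -twice /cross mulr_suml -sumrB; apply: eq_bigr => i _.
  rewrite mulr_suml -sumrB; apply: eq_bigr => j _.
  by rewrite /a /b sqnorm_flippedB // /side !inE; field.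
have BA : \sum_i \sum_j 1%:R * (1 - entry X (inr j) (inl i))
    = 2 * (#|VA|%:R * #|VB|%:R) - cross / 2.
  rewrite -AB; apply: eq_bigr => i _; apply: eq_bigr => j _.
  by case: X_feas => X_sym _ _; rewrite /entry -{1}X_sym mxE.
by rewrite AA BB AB BA /inner; field.
Qed.

Lemma sdp_objective_join_le : sdp_objective G X <= #|VA|%:R * #|VB|%:R.
Proof.
case: (X_feas) => X_sym _ X_psd; rewrite sdp_objective_join.
have := inner_edges_le _ X_sym X_psd a b GA GB VA_gt0 lt_VA_VB deg_GB.
by rewrite -/inner -/cross; lra.
Qed.

Lemma sdp_objective_join_max :
  sdp_objective G X = #|VA|%:R * #|VB|%:R -> X = cut_mx S.
Proof.
case: (X_feas) => X_sym _ X_psd; rewrite sdp_objective_join => objE.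
have sums_eq : inner / 2 = cross by lra.
have [c [null_a null_b]] := inner_edges_eq _ X_sym X_psd a b GA GB VA_gt0
  lt_VA_VB deg_GB (fun i => sqnorm_flipped _ _ X_feas _)
  (fun j => sqnorm_flipped _ _ X_feas _) sums_eq.
apply: eq_cut_mx => // u v; apply: (sqnormB_eq0_trans _ X_sym X_psd _ _ c).
  by case: u => [i|j]; [apply: null_a | apply: null_b].
by case: v => [i|j]; [apply: null_a | apply: null_b].
Qed.

End Feasible.

Lemma sdp_objective_left_side :
  sdp_objective G (cut_mx S : 'M[R]__) = #|VA|%:R * #|VB|%:R.
Proof.
have feas := cut_mx_feasible (R := R) S.
have null u v : sqnorm (cut_mx S) (flipped S u - flipped S v) = 0 :> R.
  by rewrite sqnorm_flippedB // entry_cut_mx mulrACA !side2; ring.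
have no_inner (W : finType) (f : W -> VA + VB) (H : sgraph W) :
    edge_sum (cut_mx S) (fun w => flipped S (f w)) H = 0 :> R.
  by apply: big1 => i _; apply: big1 => j _; rewrite null mulr0.
rewrite sdp_objective_join // !no_inner big1 => [|i _]; first by ring.
by apply: big1 => j _; rewrite null.
Qed.

Lemma left_side_optimal : sdp_optimal G (cut_mx S : 'M[R]__).
Proof.
split=> [|Y Y_feas]; first exact: cut_mx_feasible.
by rewrite sdp_objective_left_side sdp_objective_join_le.
Qed.

End Join.

Theorem proposition4 (R : realType) (VA VB : finType)
    (GA : sgraph VA) (GB : sgraph VB)
    (VA_neq0 : (0 < #|VA|)%N) (VB_neq0 : (0 < #|VB|)%N)
    (lt_VA_VB : (#|VA| < #|VB|)%N)
    (deg_GB : forall v : VB, (degree GB v)%:R <= 2^-1 * #|VA|%:R :> R) :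
  exact R (join GA GB) /\
  exists! X : 'M[R]_#|{: VA + VB}|, sdp_optimal (join GA GB) X.
Proof.
have opt := left_side_optimal GA GB VA_neq0 lt_VA_VB deg_GB.
split; first exact: exact_of_optimal_cut opt.
exists (cut_mx left_side); split=> // Y [Y_feas Y_max].
apply: esym; apply: (sdp_objective_join_max GA GB VA_neq0 lt_VA_VB deg_GB _ Y_feas).
apply/eqP; rewrite eq_le sdp_objective_join_le //=.
by rewrite -(sdp_objective_left_side GA GB) Y_max //; apply: cut_mx_feasible.
Qed.
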